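(* Let $\mathcal{I}$ be a finite category (finitely many objects and morphisms) for which the series Euler characteristic $\chi_{\Sigma}(\mathcal{I})$ is defined. Then the Euler characteristic $\chi_{\mathrm{fil}}(\mathrm{Sd}(\mathcal{I}),L)$ of the $\mathbb{N}$-filtered acyclic category $(\mathrm{Sd}(\mathcal{I}),L)$ is also defined, where $\mathrm{Sd}(\mathcal{I})$ is the barycentric subdivision and $L$ is the length functor, and $$\chi_{\Sigma}(\mathcal{I})=\chi_{\mathrm{fil}}(\mathrm{Sd}(\mathcal{I}),L).$$
   Context: Conventions: $\mathbb{N}=\{0,1,2,\dots\}$, regarded as a poset, hence as a category; $[n]=\{0<1<\dots<n\}$ is likewise regarded as a category. Non-degenerate nerve: for a small category $\mathcal{J}$, $\overline{N_n}(\mathcal{J})$ is the set of sequences $x_0\xrightarrow{f_1}x_1\xrightarrow{f_2}\cdots\xrightarrow{f_n}x_n$ of composable morphisms of $\mathcal{J}$ in which no $f_i$ is an identity morphism; $\overline{N_0}(\mathcal{J})=\mathrm{Ob}(\mathcal{J})$. An element of $\overline{N_n}(\mathcal{J})$ is also regarded as a functor $[n]\to\mathcal{J}$. If $X\in\overline{N_n}(\mathcal{J})$, its length is $q_X=n$. Barycentric subdivision: $\mathrm{Sd}(\mathcal{J})$ is the category whose objects are all elements of $\coprod_{n\ge 0}\overline{N_n}(\mathcal{J})$, and in which the morphisms $X\to Y$ are the equivalence classes $[f]$ of order-preserving maps $f:[q_X]\to[q_Y]$ with $Y\circ f=X$ (as functors), modulo the equivalence relation generated by: $f\sim g$ if for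 every $0\le i\le q_X$ the morphism $Y(\min\{f(i),g(i)\}\to\max\{f(i),g(i)\})$ is an identity morphism of $\mathcal{J}$. Composition is induced by composition of order-preserving maps. Acyclic category: a small category $\mathcal{A}$ in which all endomorphisms are identities and such that if there is a morphism $X\to Y$ with $X\neq Y$, then there is no morphism $Y\to X$. On $\mathrm{Ob}(\mathcal{A})$ put $x\le y$ if there is a morphism $x\to y$. For every small category $\mathcal{J}$, $\mathrm{Sd}(\mathcal{J})$ is acyclic. $\mathbb{N}$-filtration: an $\mathbb{N}$-filtration of an acyclic category $\mathcal{A}$ is a functor $\mu:\mathcal{A}\to\mathbb{N}$ with $\mu(x)<\mu(y)$ whenever $x<y$ in $\mathrm{Ob}(\mathcal{A})$; the pair $(\mathcal{A},\mu)$ is called an $\mathbb{N}$-filtered acyclic category. The length functor $L:\mathrm{Sd}(\mathcal{J})\to\mathbb{N}$, $L(X)=q_X$, is an $\mathbb{N}$-filtration of $\mathrm{Sd}(\mathcal{J})$. Evaluation at $-1$: for a formal power series $f(t)\in\mathbb{Z}[[t]]$, if there is a rational function $g(t)/h(t)\in\mathbb{Q}(t)$ with $f(t)=g(t)/h(t)$ in $\mathbb{Q}((t))$ and $h(-1)\ne 0$, then $f|_{t=-1}:=g(-1)/h(-1)\in\mathbb{Q}$; otherwise $f|_{t=-1}$ is undefined. Series Euler characteristic: for a finite category $\mathcal{I}$, $\chi_{\Sigma}(\mathcal{I})=\left(\sum_{n=0}^\infty \#\overline{N_n}(\mathcal{I})\,t^n\right)\big|_{t=-1}$, if this is defined. Euler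 characteristic of an $\mathbb{N}$-filtered acyclic category $(\mathcal{A},\mu)$: let $\overline{N_i}(\mathcal{A})_n$ be the set of chains $x_0\to x_1\to\cdots\to x_i$ in $\overline{N_i}(\mathcal{A})$ with $\max(\mu(x_0),\dots,\mu(x_i))=n$. Suppose each $\overline{N_i}(\mathcal{A})_n$ is finite and $\overline{N_i}(\mathcal{A})_n=\emptyset$ if $n<i$. Put $$f_\chi(\mathcal{A},\mu)(t)=\sum_{n=0}^\infty(-1)^n\left(\sum_{i=0}^n(-1)^i\,\#\overline{N_i}(\mathcal{A})_n\right)t^n\in\mathbb{Z}[[t]],$$ and $\chi_{\mathrm{fil}}(\mathcal{A},\mu)=f_\chi(\mathcal{A},\mu)(t)|_{t=-1}$ if this exists. Thus ''$\chi_{\mathrm{fil}}(\mathcal{A},\mu)$ is defined'' means that these finiteness and emptiness conditions hold and the evaluation at $t=-1$ exists. *)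

(* Defs.v *)
From HB Require Import structures.
From mathcomp Require Import all_boot all_order all_algebra.
From mathcomp Require Import generic_quotient finmap.
From mathcomp Require Import boolp classical_sets functions cardinality.
From Stdlib Require Import Relation_Operators.

Set Implicit Arguments.
Unset Strict Implicit.
Unset Printing Implicit Defensive.

Import Order.TTheory GRing.Theory Num.Theory.
Local Open Scope classical_set_scope.
Local Open Scope quotient_scope.

Record category := Category {
  ob :> Type;
  hom : ob -> ob -> Type;
  idm : forall x, hom x x;
  comp : forall x y z, hom y z -> hom x y -> hom x z;
  comp_idl : forall x y (f : hom x y), comp (idm y) f = f;
  comp_idr : forall x y (f : hom x y), comp f (idm x) = f;
  comp_assoc : forall x y z w (h : hom z w) (g : hom y z) (f : hom x y),
    comp h (comp g f) = comp (comp h g) f }.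

Arguments hom {c} x y : rename.
Arguments idm {c} x : rename.
Arguments comp {c x y z} g f : rename.

(* "f is an identity morphism": this forces source and target to be equal. *)
Inductive is_id (C : category) : forall x y : C, hom x y -> Prop :=
  IsId x : is_id (idm x).

Definition finite_category (C : category) : Prop :=
  finite_set [set: C] /\
  finite_set [set: {x : C & {y : C & hom x y}}].

Record functor (C D : category) := Functor {
  fob :> C -> D;
  fmap : forall x y, hom x y -> hom (fob x) (fob y);
  fmap_id : forall x, fmap (idm x) = idm (fob x);
  fmap_comp : forall x y z (g : hom y z) (f : hom x y),
    fmap (comp g f) = comp (fmap g) (fmap f) }.

Arguments fmap {C D} f {x y} h : rename.

Lemma functor_ext (C D : category) (ob : C -> D)
    (m m' : forall x y, hom x y -> hom (ob x) (ob y)) mi mc mi' mc' :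
  (forall x y (h : hom x y), m x y h = m' x y h) ->
  @Functor C D ob m mi mc = @Functor C D ob m' mi' mc'.
Proof.
move=> mm'; have e : m = m'.
  by apply: functional_extensionality_dep => x;
     apply: functional_extensionality_dep => y; apply/funext => h.
by subst m'; congr Functor; exact: Prop_irrelevance.
Qed.

Section FunctorComp.
Variables (C D E : category) (G : functor D E) (F : functor C D).

Fact functor_comp_id x : fmap G (fmap F (idm x)) = idm (G (F x)).
Proof. by rewrite !fmap_id. Qed.

Fact functor_comp_comp x y z (g : hom y z) (f : hom x y) :
  fmap G (fmap F (comp g f)) = comp (fmap G (fmap F g)) (fmap G (fmap F f)).
Proof. by rewrite !fmap_comp. Qed.

Definition functor_comp : functor C E :=
  @Functor C E (fun x => G (F x)) (fun x y f => fmap G (fmap F f))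
    functor_comp_id functor_comp_comp.

End FunctorComp.

Section PosetCategory.
Variables (d : Order.disp_t) (T : porderType d).

Definition poset_cat : category :=
  @Category T (fun x y => (x <= y)%O) (fun x => lexx x)
    (fun x y z yz xy => le_trans xy yz)
    (fun _ _ _ => bool_irrelevance _ _)
    (fun _ _ _ => bool_irrelevance _ _)
    (fun _ _ _ _ _ _ _ => bool_irrelevance _ _).

End PosetCategory.

Definition nat_cat : category := poset_cat nat.

(* [ord_cat n] is [n] = {0 < 1 < ... < n}, with n + 1 objects. *)
Definition ord_cat (n : nat) : category := poset_cat 'I_n.+1.

Definition homo_functor d d' (T : porderType d) (T' : porderType d')
    (f : T -> T') (hf : {homo f : x y / (x <= y)%O}) :
    functor (poset_cat T) (poset_cat T') :=
  @Functor (poset_cat T) (poset_cat T') f hf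
    (fun _ => bool_irrelevance _ _) (fun _ _ _ _ _ => bool_irrelevance _ _).

(* [nd_chain n x]: sequences x = x_0 -> x_1 -> ... -> x_n of composable
   non-identity morphisms. *)
Inductive nd_chain (C : category) : nat -> C -> Type :=
| nd_nil x : nd_chain 0 x
| nd_cons n x y (f : hom x y) :
    ~ is_id f -> nd_chain n y -> nd_chain n.+1 x.

Arguments nd_nil {C} x.
Arguments nd_cons {C n x y} f nf c.

Definition nd_nerve (C : category) (n : nat) : Type :=
  {x : C & nd_chain n x}.

Section ChainFunctor.
Variable C : category.

(* The i-th object; indices beyond the end stay at the last object. *)
Fixpoint chain_ob n (x : C) (c : nd_chain n x) (i : nat) : C :=
  match c, i with
  | nd_nil x, _ => x
  | nd_cons _ x _ _ _ _, 0 => x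
  | nd_cons _ _ _ _ _ c', i'.+1 => chain_ob c' i'
  end.

(* The composite x_0 -> x_j. *)
Fixpoint chain_from0 n (x : C) (c : nd_chain n x) (j : nat) :
    hom x (chain_ob c j) :=
  match c as c in nd_chain n x return hom x (chain_ob c j) with
  | nd_nil x => idm x
  | nd_cons n x y f nf c' =>
      match j return hom x (chain_ob (nd_cons f nf c') j) with
      | 0 => idm x
      | j'.+1 => comp (chain_from0 c' j') f
      end
  end.

(* The composite x_i -> x_j, for i <= j. *)
Fixpoint chain_hom n (x : C) (c : nd_chain n x) (i j : nat) :
    (i <= j)%N -> hom (chain_ob c i) (chain_ob c j) :=
  match c as c in nd_chain n x
    return (i <= j)%N -> hom (chain_ob c i) (chain_ob c j) with
  | nd_nil x => fun _ => idm x
  | nd_cons n x y f nf c' =>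
      match i, j return (i <= j)%N ->
        hom (chain_ob (nd_cons f nf c') i) (chain_ob (nd_cons f nf c') j) with
      | 0, j' => fun _ => chain_from0 (nd_cons f nf c') j'
      | i'.+1, 0 => fun h => False_rect _ (notF h)
      | i'.+1, j'.+1 => fun h => chain_hom c' (h : (i' <= j')%N)
      end
  end.

Lemma chain_hom_id n (x : C) (c : nd_chain n x) i (h : (i <= i)%N) :
  chain_hom c h = idm (chain_ob c i).
Proof.
elim: c i h => [{}x|{}n {}x y f nf c IH] [|i] h //=; exact: IH.
Qed.

Lemma chain_from0_hom n (x : C) (c : nd_chain n x) j k (jk : (j <= k)%N) :
  chain_from0 c k = comp (chain_hom c jk) (chain_from0 c j).
Proof.
elim: c j k jk => [{}x|{}n {}x y f nf c IH] [|j] [|k] jk //=;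
  rewrite ?comp_idl ?comp_idr //.
by rewrite (IH j k jk) comp_assoc.
Qed.

Lemma chain_hom_comp n (x : C) (c : nd_chain n x) i j k
    (ij : (i <= j)%N) (jk : (j <= k)%N) (ik : (i <= k)%N) :
  chain_hom c ik = comp (chain_hom c jk) (chain_hom c ij).
Proof.
elim: c i j k ij jk ik => [{}x|{}n {}x y f nf c IH] [|i] [|j] [|k] ij jk ik //=;
  rewrite ?comp_idl ?comp_idr //.
by rewrite (chain_from0_hom c (jk : (j <= k)%N)) comp_assoc.
Qed.

Definition chain_functor n (X : nd_nerve C n) : functor (ord_cat n) C :=
  @Functor (ord_cat n) C (fun i => chain_ob (projT2 X) i)
    (fun i j (h : (i <= j)%O) => chain_hom (projT2 X) (h : (i <= j)%N))
    (fun i => chain_hom_id (projT2 X) (lexx i : (i <= i)%N))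
    (fun i j k jk ij => chain_hom_comp (projT2 X) ij jk (le_trans ij jk)).

End ChainFunctor.

Definition sd_ob (C : category) : Type := {n : nat & nd_nerve C n}.

Definition len (C : category) (X : sd_ob C) : nat := projT1 X.

Definition sd_functor (C : category) (X : sd_ob C) :
    functor (ord_cat (len X)) C :=
  chain_functor (projT2 X).

Lemma min_le_max d (T : orderType d) (x y : T) :
  (Order.min x y <= Order.max x y)%O.
Proof. by rewrite ge_min !le_max lexx. Qed.

Section SdMorphisms.
Variable C : category.

Record sd_map (X Y : sd_ob C) := SdMap {
  sd_fun :> 'I_(len X).+1 -> 'I_(len Y).+1;
  sd_homo : {homo sd_fun : i j / (i <= j)%O};
  sd_comm : functor_comp (sd_functor Y) (homo_functor sd_homo)
            = sd_functor X }.

HB.instance Definition _ (X Y : sd_ob C) := gen_eqMixin (sd_map X Y).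
HB.instance Definition _ (X Y : sd_ob C) := gen_choiceMixin (sd_map X Y).

Definition sd_rel (X Y : sd_ob C) (f g : sd_map X Y) : Prop :=
  forall i, is_id (@fmap (ord_cat (len Y)) C (sd_functor Y) _ _
                     (min_le_max (f i) (g i))).

Definition sd_equiv (X Y : sd_ob C) : rel (sd_map X Y) :=
  fun f g => `[< clos_refl_sym_trans _ (@sd_rel X Y) f g >].

Lemma sd_equiv_is_equiv (X Y : sd_ob C) : equiv_class_of (@sd_equiv X Y).
Proof.
split.
- by move=> f; apply/asboolP; apply: rst_refl.
- by move=> f g; apply/asboolP/asboolP; apply: rst_sym.
- by move=> f g h /asboolP fg /asboolP gh; apply/asboolP; exact: rst_trans gh.
Qed.

Canonical sd_equiv_rel (X Y : sd_ob C) :=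
  EquivRelPack (sd_equiv_is_equiv X Y).

Definition sd_hom (X Y : sd_ob C) : Type := {eq_quot (sd_equiv_rel X Y)}.

End SdMorphisms.

Section SdCategory.
Variable C : category.
Implicit Types X Y Z W : sd_ob C.

Lemma sd_comm_ob X Y (f : sd_map X Y) i : sd_functor Y (f i) = sd_functor X i.
Proof. by rewrite -(sd_comm f). Qed.

Fact sd_map_id_comm X :
  functor_comp (sd_functor X)
    (homo_functor (fun i j (h : (i <= j)%O) => h : (id i <= id j)%O))
  = sd_functor X.
Proof. by case: X => n [x c]; congr Functor; exact: Prop_irrelevance. Qed.

Definition sd_map_id X : sd_map X X := SdMap (sd_map_id_comm X).

Fact sd_map_comp_comm X Y Z (g : sd_map Y Z) (f : sd_map X Y) :
  functor_comp (sd_functor Z)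
    (homo_functor (fun i j (h : (i <= j)%O) => sd_homo g (sd_homo f h)))
  = sd_functor X.
Proof.
rewrite -(sd_comm f) -(sd_comm g).
by congr Functor; exact: Prop_irrelevance.
Qed.

Definition sd_map_comp X Y Z (g : sd_map Y Z) (f : sd_map X Y) : sd_map X Z :=
  SdMap (sd_map_comp_comm g f).

Lemma sd_map_eq X Y (f g : sd_map X Y) : f =1 g -> f = g.
Proof.
case: f g => [f hf cf] [g hg cg] /= /funext fg; move: hf cf hg cg.
rewrite fg => hf cf hg; rewrite (Prop_irrelevance hg hf) => cg.
by rewrite (Prop_irrelevance cg cf).
Qed.

Lemma is_id_functor_eq (A B : category) (F G : functor A B) x y (h : hom x y) :
  F = G -> is_id (fmap F h) -> is_id (fmap G h).
Proof. by case: _ /. Qed.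

Lemma is_id_poset_eq d (T : porderType d) (D : category)
    (F : functor (poset_cat T) D) (a b a' b' : T) (h : (a <= b)%O)
    (h' : (a' <= b')%O) :
  a = a' -> b = b' ->
  is_id (@fmap (poset_cat T) D F a b h) ->
  is_id (@fmap (poset_cat T) D F a' b' h').
Proof. by move=> ea eb; subst a' b'; rewrite (bool_irrelevance h h'). Qed.

Lemma sd_rel_comp_l X Y Z (g : sd_map Y Z) (f f' : sd_map X Y) :
  sd_rel f f' -> sd_rel (sd_map_comp g f) (sd_map_comp g f').
Proof.
move=> ff' i; move: (ff' i) => /(is_id_functor_eq (esym (sd_comm g))).
have minE : g (Order.min (f i) (f' i)) = Order.min (g (f i)) (g (f' i)).
  case: (leP (f i) (f' i)) => h; first by rewrite min_l // sd_homo.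
  by rewrite min_r // sd_homo // ltW.
have maxE : g (Order.max (f i) (f' i)) = Order.max (g (f i)) (g (f' i)).
  case: (leP (f i) (f' i)) => h; first by rewrite max_r // sd_homo.
  by rewrite max_l // sd_homo // ltW.
exact: (@is_id_poset_eq _ _ C (sd_functor Z) _ _ _ _ _ _ minE maxE).
Qed.

Lemma sd_rel_comp_r X Y Z (g g' : sd_map Y Z) (f : sd_map X Y) :
  sd_rel g g' -> sd_rel (sd_map_comp g f) (sd_map_comp g' f).
Proof. by move=> gg' i; exact: gg'. Qed.

Lemma sd_pi_eq X Y (f g : sd_map X Y) :
  \pi_(sd_hom X Y) f = \pi_(sd_hom X Y) g <->
  clos_refl_sym_trans _ (@sd_rel C X Y) f g.
Proof.
split=> [/eqmodP /asboolP //|fg]; apply/eqmodP; exact/asboolP.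
Qed.

Definition sd_id X : sd_hom X X := \pi_(sd_hom X X) (sd_map_id X).

Definition sd_comp X Y Z (G : sd_hom Y Z) (F : sd_hom X Y) : sd_hom X Z :=
  \pi_(sd_hom X Z) (sd_map_comp (repr G) (repr F)).

Lemma sd_compE X Y Z (g : sd_map Y Z) (f : sd_map X Y) :
  sd_comp (\pi_(sd_hom Y Z) g) (\pi_(sd_hom X Y) f)
  = \pi_(sd_hom X Z) (sd_map_comp g f).
Proof.
apply/sd_pi_eq.
have /sd_pi_eq rg := reprK (\pi_(sd_hom Y Z) g).
have /sd_pi_eq rf := reprK (\pi_(sd_hom X Y) f).
move: (repr (\pi_(sd_hom Y Z) g)) (repr (\pi_(sd_hom X Y) f)) rg rf => g' f' rg rf.
apply: (@rst_trans _ _ _ (sd_map_comp g f')).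
- elim: rg => [a b ab|a|a b _ IH|a b c _ IH1 _ IH2].
  + exact/rst_step/sd_rel_comp_r.
  + exact: rst_refl.
  + exact: rst_sym.
  + exact: rst_trans IH2.
- elim: rf => [a b ab|a|a b _ IH|a b c _ IH1 _ IH2].
  + exact/rst_step/sd_rel_comp_l.
  + exact: rst_refl.
  + exact: rst_sym.
  + exact: rst_trans IH2.
Qed.

Fact sd_comp_idl X Y (F : sd_hom X Y) : sd_comp (sd_id Y) F = F.
Proof. by elim/quotW: F => f; rewrite sd_compE; congr (\pi_(sd_hom _ _) _); exact: sd_map_eq. Qed.

Fact sd_comp_idr X Y (F : sd_hom X Y) : sd_comp F (sd_id X) = F.
Proof. by elim/quotW: F => f; rewrite sd_compE; congr (\pi_(sd_hom _ _) _); exact: sd_map_eq. Qed.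

Fact sd_comp_assoc X Y Z W (H : sd_hom Z W) (G : sd_hom Y Z) (F : sd_hom X Y) :
  sd_comp H (sd_comp G F) = sd_comp (sd_comp H G) F.
Proof.
elim/quotW: F => f; elim/quotW: G => g; elim/quotW: H => h.
rewrite (sd_compE g f) (sd_compE h g) (sd_compE h (sd_map_comp g f)).
rewrite (sd_compE (sd_map_comp h g) f).
by congr (\pi_(sd_hom _ _) _); exact: sd_map_eq.
Qed.

Definition Sd : category := Category sd_comp_idl sd_comp_idr sd_comp_assoc.

End SdCategory.

Definition acyclic (A : category) : Prop :=
  (forall (x : A) (f : hom x x), f = idm x) /\
  (forall x y : A, x <> y -> inhabited (hom x y) -> ~ inhabited (hom y x)).

Definition ob_le (A : category) (x y : A) : Prop := inhabited (hom x y).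

Definition ob_lt (A : category) (x y : A) : Prop := ob_le x y /\ x <> y.

Definition nat_filtration (A : category) (mu : functor A nat_cat) : Prop :=
  forall x y : A, ob_lt x y -> (mu x < mu y :> nat)%O.

Record filtered_acyclic := FilteredAcyclic {
  fa_cat :> category;
  fa_acyclic : acyclic fa_cat;
  fa_mu : functor fa_cat nat_cat;
  fa_filtration : nat_filtration fa_mu }.

Section Length.
Variable C : category.
Implicit Types X Y : sd_ob C.

Lemma chain_hom_nd n (x : C) (c : nd_chain n x) i (h : (i <= i.+1)%N) :
  (i < n)%N -> ~ is_id (chain_hom c h).
Proof.
elim: c i h => [{}x|{}n {}x y f nf c IH] [|i] h //= lt_in; last exact: IH.
by case: c {IH} f nf => [z f|m z w g ng c f] /=; rewrite comp_idl.
Qed.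

Lemma sd_map_mono X Y (f : sd_map X Y) : {homo f : i j / (i < j)%O}.
Proof.
move=> i j lt_ij; rewrite lt_neqAle sd_homo ?(ltW lt_ij) // andbT.
apply/eqP => fij.
have lt_in : (i < len X)%N.
  have : (i < j)%N by [].
  by move=> /leq_trans; apply; rewrite -ltnS.
have lt_in' : (i.+1 < (len X).+1)%N by [].
pose i' := Ordinal lt_in'.
have ii' : (i <= i')%O by exact: leqnSn.
have i'j : (i' <= j)%O by [].
have fii' : f i' = f i.
  by apply: le_anti; rewrite {1}fij !sd_homo.
have nid : ~ is_id (@fmap (ord_cat (len X)) C (sd_functor X) i i' ii').
  exact: (@chain_hom_nd _ _ (projT2 (projT2 X))).
apply: nid; apply: (is_id_functor_eq (sd_comm f)) => /=.
move: (sd_homo f ii'); rewrite fii' => h.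
rewrite chain_hom_id; exact: IsId.
Qed.

Lemma sd_map_ge X Y (f : sd_map X Y) (i : 'I_(len X).+1) : (i <= f i)%N.
Proof.
case: i => i; elim: i => [//|i IH] lt_i.
have lt_i' := ltnW lt_i.
apply: (leq_ltn_trans (IH lt_i')).
by have := @sd_map_mono X Y f (Ordinal lt_i') (Ordinal lt_i); apply; exact: ltnSn.
Qed.

Lemma sd_hom_len X Y (F : @hom (Sd C) X Y) : (len X <= len Y)%O.
Proof.
have f : sd_map X Y := repr F.
by rewrite leEnat -ltnS; apply: leq_ltn_trans (sd_map_ge f ord_max) (ltn_ord _).
Qed.

Lemma homo_lt_id n (f : 'I_n.+1 -> 'I_n.+1) : {homo f : i j / (i < j)%O} ->
  (forall i : 'I_n.+1, (i <= f i)%N) -> f =1 id.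
Proof.
move=> hf ge_f [i lt_i]; apply/val_inj/eqP; rewrite /= eqn_leq (ge_f (Ordinal lt_i)) andbT.
move: lt_i; have [k] := ubnP (n - i); elim: k i => // k IH i lt_k lt_i.
have [lt_in|ge_in] := ltnP i n; last first.
  by rewrite (leq_trans _ ge_in) // -ltnS ltn_ord.
have lt_i' : (i.+1 < n.+1)%N by [].
have := hf (Ordinal lt_i) (Ordinal lt_i') (ltnSn i).
move=> /leq_trans /(_ (IH i.+1 _ lt_i')); rewrite ltnS; apply.
by rewrite subnS; case: (n - i)%N lt_k (subn_gt0 i n) => [|m]; rewrite ?lt_in.
Qed.

Lemma existT_inj (T : Type) (P : T -> Type) x (p q : P x) :
  existT P x p = existT P x q -> p = q.
Proof.
move=> e; have := projT2_eq e; move: (projT1_eq e) => /= e1.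
by rewrite (Prop_irrelevance e1 erefl).
Qed.

Lemma nd_chain0E (x : C) (c : nd_chain 0 x) : c = nd_nil x.
Proof.
exact: (match c as c in nd_chain m x return
  match m return nd_chain m x -> Prop with
  | 0 => fun c => c = nd_nil x | _.+1 => fun _ => True end c
  with nd_nil _ => erefl | nd_cons _ _ _ _ _ _ => I end).
Qed.

Lemma nd_chainSE n (x : C) (c : nd_chain n.+1 x) :
  exists y (f : hom x y) nf (c' : nd_chain n y), c = nd_cons f nf c'.
Proof.
refine (match c as c in nd_chain m x return
  match m return nd_chain m x -> Prop with
  | 0 => fun _ => True
  | m'.+1 => fun c =>
      exists y (f : hom x y) nf (c' : nd_chain m' y), c = nd_cons f nf c'
  end c with nd_nil _ => I | nd_cons m' x' y f nf c' => _ end).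
by exists y, f, nf, c'.
Qed.

Lemma homo_lift0 n : {homo (lift ord0 : 'I_n.+1 -> 'I_n.+2) : i j / (i <= j)%O}.
Proof. by move=> i j ij; rewrite leEord /= leq_bump2. Qed.

Lemma chain_functor_cons n (x y : C) (f : hom x y) nf (c : nd_chain n y) :
  functor_comp (chain_functor (existT _ x (nd_cons f nf c)))
    (homo_functor (@homo_lift0 n)) = chain_functor (existT _ y c).
Proof.
apply: functor_ext => i j h /=; congr chain_hom; exact: bool_irrelevance.
Qed.

Lemma chain_functor_inj n : injective (@chain_functor C n).
Proof.
elim: n => [|n IH] [x c] [x' c'] E.
  have /= ex := congr1 (fun F : functor (ord_cat 0) C => F ord0) E.
  rewrite (nd_chain0E c) (nd_chain0E c') /= in ex *.
  by rewrite ex.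
have [y [f [nf [d ec]]]] := nd_chainSE c.
have [y' [f' [nf' [d' ec']]]] := nd_chainSE c'.
subst c c'.
have /IH E' : chain_functor (existT _ y d) = chain_functor (existT _ y' d').
  by rewrite -(chain_functor_cons nf) -(chain_functor_cons nf') E.
have /= ex := congr1 (fun F : functor (ord_cat n.+1) C => F ord0) E.
have ey := projT1_eq E'; rewrite /= in ey; subst x' y'.
have ed := existT_inj E'; subst d'.
pose i1 : 'I_n.+2 := lift ord0 ord0.
have le01 : ((ord0 : 'I_n.+2) <= i1)%O by [].
have /= e1 := congr1 (fun F : functor (ord_cat n.+1) C =>
  existT (fun a => {b & hom a b}) (F ord0)
    (existT _ (F i1) (@fmap (ord_cat n.+1) C F ord0 i1 le01))) E.
have {e1} := existT_inj e1.
have aux (g : hom x y) : existT (fun b => hom x b) (chain_ob d 0)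
    (comp (chain_from0 d 0) g) = existT _ y g.
  by case: d g {E E' f f' nf nf'} => [z|m z w k nk d] g /=; rewrite comp_idl.
rewrite !aux => e1; have ef := existT_inj e1; subst f'.
by rewrite (Prop_irrelevance nf nf').
Qed.

Lemma sd_map_len_eq X Y (f : sd_map X Y) : len X = len Y -> X = Y.
Proof.
case: X Y f => [n X] [m Y] f /= e; subst m.
have f_id : f =1 id by exact: homo_lt_id (sd_map_mono f) (sd_map_ge f).
congr existT; apply: chain_functor_inj; rewrite -[LHS](sd_comm f).
move: (sd_homo f); rewrite (funext f_id) => h.
apply: functor_ext => i j ij /=; congr chain_hom; exact: bool_irrelevance.
Qed.

Lemma Sd_acyclic : acyclic (Sd C).
Proof.
split=> [X F|X Y XY [F] [G]].
  elim/quotW: F => f; congr (\pi_(sd_hom _ _) _).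
  by apply: sd_map_eq; exact: homo_lt_id (sd_map_mono f) (sd_map_ge f).
apply: XY; apply: (sd_map_len_eq (repr F)).
by apply: le_anti; rewrite (sd_hom_len F) (sd_hom_len G).
Qed.

Definition len_hom X Y (F : @hom (Sd C) X Y) : @hom nat_cat (len X) (len Y) :=
  sd_hom_len F.

Definition length_functor : functor (Sd C) nat_cat :=
  @Functor (Sd C) nat_cat (@len C) len_hom
    (fun _ => bool_irrelevance _ _) (fun _ _ _ _ _ => bool_irrelevance _ _).

Lemma length_filtration : nat_filtration length_functor.
Proof.
move=> X Y [[F] XY]; rewrite lt_neqAle (sd_hom_len F) andbT.
by apply/eqP => /(sd_map_len_eq (repr F)).
Qed.

Definition Sd_filtered : filtered_acyclic :=
  FilteredAcyclic Sd_acyclic length_filtration.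

End Length.

Local Open Scope ring_scope.

(* A power series with integer coefficients is its sequence of coefficients.
   [f = g / h] in Q((t)) is read as [f * h = g], by Cauchy product. *)
Definition series_is_frac (f : nat -> int) (g h : {poly rat}) : Prop :=
  forall n, \sum_(i < n.+1) (f i)%:~R * h`_(n - i) = g`_n.

Definition evaluates_to (f : nat -> int) (v : rat) : Prop :=
  exists g h : {poly rat},
    [/\ h.[-1] != 0, series_is_frac f g h & v = g.[-1] / h.[-1]].

Definition evaluable (f : nat -> int) : Prop := exists v, evaluates_to f v.

(* f|_{t = -1}, with the arbitrary value 0 when it is undefined. *)
Definition eval_m1 (f : nat -> int) : rat := xget 0 [set v | evaluates_to f v].

Lemma evaluates_to_uniq f v w : evaluates_to f v -> evaluates_to f w -> v = w.
Proof.
move=> [g [h [h0 fgh ->]]] [g' [h' [h'0 fgh' ->]]].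
suff e : g * h' = g' * h.
  have /(congr1 (fun p : {poly rat} => p.[-1])) := e; rewrite !hornerM => e1.
  by apply/eqP; rewrite eqr_div // e1.
pose F N := \poly_(i < N) ((f i)%:~R : rat).
have FE k l N n : series_is_frac f k l -> (n < N)%N -> (F N * l)`_n = k`_n.
  move=> fkl ltnN; rewrite coefM -fkl; apply: eq_bigr => i _.
  by rewrite coef_poly (leq_ltn_trans _ ltnN) // -ltnS.
apply/polyP => n.
transitivity ((F n.+1 * h * h')`_n).
  rewrite !coefM; apply: eq_bigr => i _.
  by rewrite (FE g h n.+1 i).
rewrite mulrAC !coefM; apply: eq_bigr => i _.
by rewrite (FE g' h' n.+1 i).
Qed.

Lemma eval_m1E f v : evaluates_to f v -> eval_m1 f = v.
Proof. by move=> fv; apply: xget_unique => // w /evaluates_to_uniq; apply. Qed.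

(* The cardinality of A when A is finite; meaningless otherwise. *)
Definition ncard (T : Type) (A : set T) : nat :=
  #|` fset_set (A : set {classic T}) |%fset.

Definition nerve_series (I : category) (n : nat) : int :=
  (ncard [set: nd_nerve I n])%:Z.

Definition chi_series_defined (I : category) : Prop :=
  evaluable (nerve_series I).

Definition chi_series (I : category) : rat := eval_m1 (nerve_series I).

Section FilteredEuler.
Variable A : filtered_acyclic.

(* Chains x_0 -> ... -> x_i in the non-degenerate nerve with
   max (mu x_0, ..., mu x_i) = n. *)
Definition fil_nerve (i n : nat) : set (nd_nerve A i) :=
  [set X | (\max_(k < i.+1) (fa_mu A (chain_functor X k) : nat))%N = n].

Arguments fil_nerve : clear implicits.

Definition f_chi (n : nat) : int :=
  (-1) ^+ n * \sum_(i < n.+1) (-1) ^+ i * (ncard (fil_nerve i n))%:Z.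

Definition chi_fil_defined : Prop :=
  [/\ forall i n, finite_set (fil_nerve i n),
      forall i n, (n < i)%N -> fil_nerve i n = set0
    & evaluable f_chi].

Definition chi_fil : rat := eval_m1 f_chi.

End FilteredEuler.

(* Main.v *)
(* The two power series coincide coefficientwise.  A morphism Y -> X of Sd(I) is
   the same as a word in the classes of {0, ..., len X}, where a ~ b when
   X(a -> b) is an identity; adding or deleting the class of 0 in front of such
   words shows that the sum of (-1)^(len Y) over all morphisms Y -> X is 1.
   Let S_i be the sum of (-1)^(len x_0) over the chains x_0 -> ... -> x_i of
   Sd(I) whose maximal length is n.  Prepending an arrow to these chains gives
   #N_i(Sd(I))_n = S_i + S_(i+1), so the alternating sum over i telescopes to
   S_0 = (-1)^n #N_n(I), because S_(n+1) = 0. *)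
From HB Require Import structures.
From mathcomp Require Import all_boot all_order all_algebra.
From mathcomp Require Import generic_quotient finmap.
From mathcomp Require Import boolp classical_sets functions cardinality.
From Stdlib Require Import Relation_Operators.
Require Import Defs.

Set Implicit Arguments.
Unset Strict Implicit.
Unset Printing Implicit Defensive.

Import Order.TTheory GRing.Theory Num.Theory.
Local Open Scope classical_set_scope.
Local Open Scope quotient_scope.

(** * Comparing morphisms with different endpoints *)

Section Arrows.
Variable C : category.

(** Packing the endpoints lets morphisms whose endpoints agree only propositionally be compared by
    plain equality, without transport. *)
Definition arrow (x y : C) (f : hom x y) : {x : C & {y : C & hom x y}} :=
  existT _ x (existT _ y f).

Inductive same_arrow (x y : C) (f : hom x y) :
    forall x' y' : C, hom x' y' -> Prop :=
  SameArrow : same_arrow f f.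

Lemma arrowP (x y x' y' : C) (f : hom x y) (f' : hom x' y') :
  arrow f = arrow f' -> same_arrow f f'.
Proof.
(* Once [f'] is a projection of its packed form, rewriting with [e] replaces endpoints and morphism
   together. *)
move=> e; change (same_arrow f (projT2 (projT2 (arrow f')))).
by rewrite -e; constructor.
Qed.

Lemma arrow_inj (x y : C) : injective (@arrow x y).
Proof. by move=> f g e; exact: existT_inj (existT_inj e). Qed.

Lemma is_id_arrow (x y x' y' : C) (f : hom x y) (f' : hom x' y') :
  arrow f = arrow f' -> is_id f -> is_id f'.
Proof. by move=> /arrowP []. Qed.

Lemma arrow_comp (x y z x' y' z' : C) (f : hom x y) (g : hom y z)
    (f' : hom x' y') (g' : hom y' z') :
  arrow f = arrow f' -> arrow g = arrow g' ->
  arrow (comp g f) = arrow (comp g' f').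
Proof.
move=> /arrowP ef; case: x' y' f' / ef g' => g' eg; move: (existT_inj eg).
exact: (congr1 (fun p : {z : C & hom y z} => arrow (comp (projT2 p) f))).
Qed.

Lemma arrow_comp_idr (x y z : C) (f : hom x y) (g : hom y z) :
  is_id f -> arrow (comp g f) = arrow g.
Proof. by move=> fid; case: x y f / fid g => x g; rewrite comp_idr. Qed.

Lemma arrow_comp_idl (x y z : C) (f : hom x y) (g : hom y z) :
  is_id g -> arrow (comp g f) = arrow f.
Proof. by move=> gid; case: y z g / gid f => z' f; rewrite comp_idl. Qed.

Lemma arrow_retarget (x y z : C) (f : hom x y) :
  y = z -> exists g : hom x z, arrow g = arrow f.
Proof. by case: z /; exists f. Qed.

Lemma functor_arrow_ext (B : category) (F G : functor B C) :
  (forall x y (h : hom x y), arrow (fmap F h) = arrow (fmap G h)) -> F = G.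
Proof.
case: F G => [fo fm fi fc] [go gm gi gc] /= FG.
have e : fo = go by apply/funext => x; exact: (congr1 tag (FG _ _ (idm x))).
subst go; apply: functor_ext => x y h; exact: arrow_inj.
Qed.

Lemma chain_hom_from0 n (x : C) (c : nd_chain n x) j (h : (0 <= j)%N) :
  arrow (chain_hom c h) = arrow (chain_from0 c j).
Proof. by case: c. Qed.

End Arrows.

(** * Positions of a chain joined by an identity *)

Section CollapseRelation.
Variables (C : category) (n : nat) (F : functor (ord_cat n) C).
Implicit Types a b c : 'I_n.+1.

Let Fhom a b (ab : (a <= b)%O) := @fmap (ord_cat n) C F a b ab.

Lemma ord_fmap_comp a b c
    (ab : (a <= b)%O) (bc : (b <= c)%O) (ac : (a <= c)%O) :
  Fhom ac = comp (Fhom bc) (Fhom ab).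
Proof.
rewrite /Fhom -(@fmap_comp (ord_cat n) C F a b c bc ab).
by congr fmap; exact: bool_irrelevance.
Qed.

Lemma ord_fmap_refl a (aa : (a <= a)%O) : is_id (Fhom aa).
Proof.
have -> : aa = idm (a : ord_cat n) by exact: bool_irrelevance.
by rewrite /Fhom fmap_id.
Qed.

(** This is the condition that [sd_rel] imposes at each index. *)
Definition collapsed a b : Prop := is_id (Fhom (min_le_max a b)).

Lemma collapsedE a b (ab : (a <= b)%O) : collapsed a b <-> is_id (Fhom ab).
Proof.
by split; apply: is_id_poset_eq; rewrite ?(min_l ab) ?(max_r ab).
Qed.

Lemma collapsed_sym a b : collapsed a b -> collapsed b a.
Proof.
by apply: is_id_poset_eq; rewrite ?[Order.min b a]minC ?[Order.max b a]maxC.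
Qed.

Lemma collapsed_refl a : collapsed a a.
Proof. by apply/(collapsedE (lexx a)); exact: ord_fmap_refl. Qed.

(** For [a <= c]: if [b] lies between, [F(a -> c)] is a composite of identities; if [b] lies
    outside, it is what remains of an identity after cancelling an identity factor. *)
Lemma collapsed_trans a b c : collapsed a b -> collapsed b c -> collapsed a c.
Proof.
wlog ac : a c / (a <= c)%O => [hw ab bc|].
  have [ac|/ltW ca] := leP a c; first exact: hw.
  by apply/collapsed_sym; apply: hw; rewrite //; exact: collapsed_sym.
have [ab|/ltW ba] := leP a b; have [bc|/ltW cb] := leP b c.
- move=> /(collapsedE ab) iab /(collapsedE bc) ibc; apply/(collapsedE ac).
  rewrite (ord_fmap_comp ab bc).
  exact: is_id_arrow (esym (arrow_comp_idr _ iab)) ibc.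
- move=> /(collapsedE ab) iab /collapsed_sym /(collapsedE cb) icb.
  apply/(collapsedE ac); apply: is_id_arrow iab.
  by rewrite (ord_fmap_comp ac cb ab) arrow_comp_idl.
- move=> /collapsed_sym /(collapsedE ba) iba /(collapsedE bc) ibc.
  apply/(collapsedE ac); apply: is_id_arrow ibc.
  by rewrite (ord_fmap_comp ba ac bc) arrow_comp_idr.
- have ca := le_trans cb ba.
  have -> : c = a by apply: le_anti; rewrite ac ca.
  by move=> _ _; exact: collapsed_refl.
Qed.

(** Moving an endpoint inside its class composes with an identity. Once [a <= a'], both arrows are
    compared with [a -> b']. *)
Lemma collapsed_arrow a a' b b' (ab : (a <= b)%O) (ab' : (a' <= b')%O) :
  collapsed a a' -> collapsed b b' -> arrow (Fhom ab) = arrow (Fhom ab').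
Proof.
wlog aa' : a a' b b' ab ab' / (a <= a')%O => [hw caa cbb|].
  have [aa'|/ltW a'a] := leP a a'; first exact: hw.
  by apply/esym/hw => //; exact: collapsed_sym.
move=> /(collapsedE aa') ia cbb; have ab'' := le_trans aa' ab'.
have -> : arrow (Fhom ab') = arrow (Fhom ab'').
  by rewrite (ord_fmap_comp aa' ab') arrow_comp_idr.
have [bb'|/ltW b'b] := leP b b'.
  move: cbb => /(collapsedE bb') ib.
  by rewrite (ord_fmap_comp ab bb') arrow_comp_idl.
move: cbb => /collapsed_sym /(collapsedE b'b) ib.
by rewrite (ord_fmap_comp ab'' b'b) arrow_comp_idl.
Qed.

(** Encoding classes as finite sets of positions makes the alphabet of words a finite type. *)
Definition collapse_class a : {set 'I_n.+1} :=
  [set b | `[< collapsed a b >]]%SET.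

Lemma collapse_classP a b :
  collapse_class a = collapse_class b <-> collapsed a b.
Proof.
split=> [e|ab].
  have : b \in collapse_class b by rewrite inE; apply/asboolP/collapsed_refl.
  by rewrite -e inE => /asboolP.
apply/setP => c; rewrite !inE.
apply/asboolP/asboolP; apply: collapsed_trans => //.
exact: collapsed_sym.
Qed.

End CollapseRelation.

(** * Morphisms of the subdivision as words *)

Section Slice.
Variables (C : category) (X : sd_ob C).

Local Notation XF := (sd_functor X).
Local Notation letter := {set 'I_(len X).+1}.

(** Pointwise collapse is already an equivalence relation, so the generated closure adds nothing. *)
Lemma sd_pi_collapsed Y (f g : sd_map Y X) :
  \pi_(sd_hom Y X) f = \pi_(sd_hom Y X) g <->
  forall i, collapsed XF (f i) (g i).
Proof.
rewrite sd_pi_eq; split=> [|fg]; last exact: rst_step.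
elim=> [//|h i|h k _ IH i|h k l _ IH1 _ IH2 i].
- exact: collapsed_refl.
- exact: collapsed_sym.
- exact: collapsed_trans (IH1 i) (IH2 i).
Qed.

Definition word_of (Y : sd_ob C) (f : 'I_(len Y).+1 -> 'I_(len X).+1) :
    seq letter :=
  [seq collapse_class XF (f i) | i <- enum 'I_(len Y).+1].

Definition face_word (w : seq letter) : Prop :=
  exists Y (f : sd_map Y X), w = word_of f.

Lemma size_word_of (Y : sd_ob C) (f : 'I_(len Y).+1 -> 'I_(len X).+1) :
  size (word_of f) = (len Y).+1.
Proof. by rewrite size_map size_enum_ord. Qed.

(** The source is recovered too: the size of the word gives its length, and by [collapsed_arrow] the
    letters determine every arrow of the chain. *)
Lemma word_of_inj Y Y' (f : sd_map Y X) (f' : sd_map Y' X) :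
  word_of f = word_of f' ->
  existT (fun Y => sd_hom Y X) Y (\pi f) =
  existT (fun Y => sd_hom Y X) Y' (\pi f').
Proof.
case: Y Y' f f' => [m c] [m' c'] f f' ww.
have := congr1 size ww; rewrite !size_word_of => -[/= e]; subst m'.
have ff' i : collapsed XF (f i) (f' i).
  apply/collapse_classP.
  have := congr1 (fun w => nth finset.set0 w i) ww.
  rewrite (nth_map i) ?size_enum_ord // [RHS](nth_map i) ?size_enum_ord //.
  by rewrite (nth_ord_enum i i).
have ec : c = c'.
  apply: chain_functor_inj; rewrite -[LHS](sd_comm f) -[RHS](sd_comm f').
  apply: functor_arrow_ext => i j ij /=.
  exact: (@collapsed_arrow _ _ XF (f i) (f' i) (f j) (f' j)
            (sd_homo f ij) (sd_homo f' ij)).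
by subst c'; congr existT; apply/sd_pi_collapsed.
Qed.

(** [X(f 0 -> f 1)] is the first arrow [h] of the source chain. *)
Lemma sd_map_nondeg n x y (h : hom x y) nh (c : nd_chain n y)
    (f : sd_map (existT _ n.+1 (existT _ x (nd_cons h nh c))) X)
    (i0 := ord0 : 'I_n.+2) (i1 := lift ord0 ord0 : 'I_n.+2) :
  ~ collapsed XF (f i0) (f i1).
Proof.
have le01 : (i0 <= i1)%O by [].
move=> /(collapsedE XF (sd_homo f le01)).
have /= -> := congr1 (fun G : functor (ord_cat n.+1) C =>
  is_id (@fmap (ord_cat n.+1) C G i0 i1 le01)) (sd_comm f).
exact: (@chain_hom_nd _ _ _ (nd_cons h nh c) 0).
Qed.

Lemma face_word_pt : face_word [:: collapse_class XF ord0].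
Proof.
pose Y : sd_ob C := existT _ 0 (existT _ (XF ord0) (nd_nil _)).
pose f (i : 'I_(len Y).+1) : 'I_(len X).+1 := ord0.
have hf : {homo f : i j / (i <= j)%O} by [].
have cf : functor_comp XF (homo_functor hf) = sd_functor Y.
  apply: functor_arrow_ext => i j ij /=.
  by rewrite chain_hom_id; case: (projT2 (projT2 X)).
exists Y, (SdMap cf).
by rewrite /word_of enum_ordSl enum_ord0.
Qed.

(** Deleting the first vertex of the source chain deletes the first letter; the two letters differ
    because the deleted arrow is not an identity. *)
Lemma face_word_behead a b w : face_word [:: a, b & w] ->
  face_word (b :: w) /\ a <> b.
Proof.
move=> [[m [x c]] [f ww]].
have := congr1 size ww; rewrite size_word_of => -[/= e]; subst m.
have [y [h [nh [d ec]]]] := nd_chainSE c; subst c.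
pose Y : sd_ob C := existT _ (size w) (existT _ y d).
pose g (i : 'I_(len Y).+1) := f (lift ord0 i).
have hg : {homo g : i j / (i <= j)%O}.
  by move=> i j ij; apply: sd_homo; exact: homo_lift0.
have cg : functor_comp XF (homo_functor hg) = sd_functor Y.
  rewrite -[RHS](chain_functor_cons nh d) -[chain_functor _](sd_comm f).
  apply: functor_arrow_ext => i j ij /=.
  by congr (arrow (chain_hom _ _)); exact: bool_irrelevance.
move: ww; rewrite /word_of enum_ordSl /= enum_ordSl /= -!map_comp.
move=> -[ea eb ew].
split; last by rewrite ea eb => /collapse_classP; exact: sd_map_nondeg.
exists Y, (SdMap cg); apply: etrans (congr2 cons eb ew) _.
by rewrite /word_of enum_ordSl /= -!map_comp.
Qed.

(** Position 0 is least, so prepending it preserves monotonicity, and the condition on [b] says that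
    the new arrow [X(0 -> f 0)] is not an identity. *)
Lemma face_word_cons b w : face_word (b :: w) ->
  b <> collapse_class XF ord0 -> face_word [:: collapse_class XF ord0, b & w].
Proof.
move=> [[m [y c]] [f ww]] b0.
have := ww; rewrite /word_of enum_ordSl => -[eb _].
have n0f : ~ collapsed XF (ord0 : 'I_(len X).+1) (f ord0).
  by move=> /collapse_classP e; apply: b0; rewrite eb e.
have ey : XF (f ord0) = y.
  by rewrite sd_comm_ob /=; case: (c).
have le0f : ((ord0 : 'I_(len X).+1) <= f ord0)%O by [].
(* The arrow [X(0 -> f 0)] ends at [XF (f ord0)], which equals the head [y] of the chain only
   through [ey]. *)
have [h eh] : exists h : hom (XF ord0) y,
    arrow h = arrow (@fmap (ord_cat (len X)) C XF _ _ le0f).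
  exact: arrow_retarget.
have nh : ~ is_id h by move=> /(is_id_arrow eh) /(collapsedE XF le0f).
pose Y : sd_ob C := existT _ m.+1 (existT _ _ (nd_cons h nh c)).
pose g (i : 'I_(len Y).+1) : 'I_(len X).+1 :=
  if unlift ord0 i is Some j then f j else ord0.
have g0 : g ord0 = ord0 by rewrite /g unlift_none.
have gS j : g (lift ord0 j) = f j by rewrite /g liftK.
have hg : {homo g : i j / (i <= j)%O}.
  move=> i j; case: (unliftP ord0 i) => [i'|] ->; last by rewrite g0.
  case: (unliftP ord0 j) => [j'|] -> //.
  by rewrite !gS leEord /= leq_bump2 => ij; exact: sd_homo.
(* The endpoints [a], [a'] stay free because values of [g] match those of [f] through [gS], not by
   conversion. *)
have fE (i j : 'I_m.+1) (ij : (i <= j)%N) a a' (aa' : (a <= a')%O) :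
    f i = a -> f j = a' ->
    arrow (@fmap (ord_cat (len X)) C XF a a' aa') = arrow (chain_hom c ij).
  move=> ea ea'; subst a a'.
  have /(congr1 (fun G : functor (ord_cat m) C =>
    arrow (@fmap (ord_cat m) C G i j ij))) /= <- := sd_comm f.
  by congr (arrow (chain_hom _ _)); exact: bool_irrelevance.
have f0E (j : 'I_m.+1) a a' (aa' : (a <= a')%O) : a = ord0 -> f j = a' ->
    arrow (@fmap (ord_cat (len X)) C XF a a' aa') =
    arrow (comp (chain_from0 c j) h).
  move=> ea ea'; subst a a'.
  have le0j : ((ord0 : 'I_m.+1) <= j)%O by [].
  rewrite (ord_fmap_comp XF le0f (sd_homo f le0j) aa').
  apply: arrow_comp; first exact: esym.
  by rewrite (fE _ _ le0j) // chain_hom_from0.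
have cg : functor_comp XF (homo_functor hg) = sd_functor Y.
  apply: functor_arrow_ext => i j ij.
  case: (unliftP ord0 i) ij => [i'|] ->; case: (unliftP ord0 j) => [j'|] -> ij.
  - exact: (fE i' j' ij _ _ (hg _ _ ij)).
  - by [].
  - exact: (f0E j' _ _ (hg _ _ ij)).
  - have -> : ij = idm (ord0 : ord_cat m.+1) by exact: bool_irrelevance.
    by rewrite !fmap_id; exact: (congr1 (fun a => arrow (idm (XF a))) g0).
exists Y, (SdMap cg).
rewrite /word_of enum_ordSl /= g0 -map_comp ww; congr (_ :: _).
by apply: eq_map => i /=; rewrite gS.
Qed.

End Slice.

Local Open Scope ring_scope.

(** * Sums over finite sets of arbitrary types *)

Section FiniteSums.

Lemma finite_set_inj (T U : Type) (A : set T) (f : T -> U) :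
  {in A &, injective f} -> finite_set (f @` A) -> finite_set A.
Proof. by move=> fI; rewrite (eq_finite_set (inj_card_eq fI)). Qed.

(** [{classic T}] gives an arbitrary type decidable equality and choice. The value is meaningful
    only for finite [A]. *)
Definition set_sum (T : Type) (A : set T) (F : T -> int) : int :=
  \sum_(x <- fset_set (A : set {classic T})) F x.

Lemma mem_fset_classic (T : Type) (A : set T) (x : {classic T}) :
  finite_set A -> x \in fset_set (A : set {classic T}) <-> A x.
Proof. by move=> fA; rewrite in_fset_set // inE. Qed.

Lemma set_sum_enum (T : Type) (A : set T) (F : T -> int) (s : seq {classic T}) :
  finite_set A -> uniq s -> (forall x, x \in s <-> A x) ->
  set_sum A F = \sum_(x <- s) F x.
Proof.
move=> fA us sA; apply: perm_big; apply: uniq_perm => // x.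
by apply/idP/idP => [/(mem_fset_classic _ fA)/sA|/sA/(mem_fset_classic _ fA)].
Qed.

Lemma eq_set_sum (T : Type) (A : set T) (F G : T -> int) :
  finite_set A -> (forall x, A x -> F x = G x) -> set_sum A F = set_sum A G.
Proof.
move=> fA FG; apply: eq_big_seq => x /(mem_fset_classic _ fA); exact: FG.
Qed.

Lemma ncard_set_sum (T : Type) (A : set T) : (ncard A)%:Z = set_sum A (fun=> 1).
Proof. by rewrite /set_sum big_const_seq count_predT iter_addr_0 natz. Qed.

Lemma set_sum0 (T : Type) (F : T -> int) : set_sum set0 F = 0.
Proof. by rewrite /set_sum fset_set0 big_seq_fset0. Qed.

Lemma set_sumD1 (T : Type) (A : set T) (a : T) (F : T -> int) :
  finite_set A -> A a -> set_sum A F = F a + set_sum (A `\ a) F.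
Proof.
move=> fA Aa; have fA' := finite_setD [set a] fA.
rewrite (@set_sum_enum _ A F (a :: fset_set (A `\ a : set {classic T})))
  ?big_cons //.
  rewrite /= fset_uniq andbT.
  apply/negP => /(mem_fset_classic _ fA') [_] h; exact: h.
move=> x; rewrite inE.
split=> [/orP[/eqP -> //|/(mem_fset_classic _ fA') []] //|Ax].
have [//|xa] := eqVneq x a.
by apply/(mem_fset_classic _ fA'); split=> // e; rewrite e eqxx in xa.
Qed.

Lemma set_sum_image (T U : Type) (A : set T) (h : T -> U) (F : U -> int) :
  finite_set A -> {in A &, injective h} ->
  set_sum (h @` A) F = set_sum A (F \o h).
Proof.
move=> fA hI.
rewrite (@set_sum_enum _ _ F
  (map (h : {classic T} -> {classic U}) (fset_set (A : set {classic T})))).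
- by rewrite big_map.
- exact: finite_image.
- rewrite map_inj_in_uniq ?fset_uniq // => x y /(mem_fset_classic _ fA) Ax.
  by move=> /(mem_fset_classic _ fA) Ay; apply: hI; rewrite inE.
- move=> y; split=> [/mapP[x /(mem_fset_classic _ fA) Ax ->]|[x Ax <-]].
    by exists x.
  by apply: (map_f (h : {classic T} -> {classic U})); apply/mem_fset_classic.
Qed.

Section Sigma.
Variables (T : Type) (P : T -> Type) (A : set T) (B : forall x, set (P x)).
Hypotheses (fA : finite_set A) (fB : forall x, A x -> finite_set (@B x)).

Let AB : set {x : T & P x} := [set q | A (projT1 q) /\ B (projT2 q)].
(** One explicit enumeration of the dependent pairs yields both finiteness and the iterated sum. *)
Let ABseq := [seq (existT P x y : {classic {x : T & P x}}) |
  x <- fset_set (A : set {classic T}),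
  y <- fset_set (@B x : set {classic P x})].

Let mem_ABseq q : q \in ABseq <-> AB q.
Proof.
have pairsP := @allpairsPdep {classic T} (fun x => {classic P x})
  {classic {x : T & P x}} (fun x y => existT P x y).
split=> [/pairsP[x [y [/(mem_fset_classic _ fA) Ax]]]|].
  by move=> /(mem_fset_classic _ (fB Ax)) By ->.
case: q => x y [/= Ax By]; apply/pairsP; exists x, y.
by split=> //; apply/mem_fset_classic => //; exact: fB.
Qed.

Lemma finite_set_sigma : finite_set AB.
Proof.
have -> : AB = [set` ABseq].
  by apply/seteqP; split=> q /mem_ABseq.
exact: (@finite_seq {classic {x : T & P x}}).
Qed.

Lemma set_sum_sigma (F : {x : T & P x} -> int) :
  set_sum AB F =
  set_sum A (fun x => set_sum (@B x) (fun y => F (existT P x y))).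
Proof.
rewrite (@set_sum_enum _ _ F ABseq) ?big_allpairs_dep //.
  exact: finite_set_sigma.
apply: (@allpairs_uniq_dep {classic T} (fun x => {classic P x})
  {classic {x : T & P x}} (fun x y => existT P x y)) =>
  [|x _|[x y] [x' y'] _ _ /= e]; rewrite ?fset_uniq //.
Qed.

End Sigma.

End FiniteSums.

(** * Alternating sums over the morphisms into an object *)

Lemma is_id_slice (A : category) (x : A) (p : {y : A & hom y x}) :
  is_id (projT2 p) -> p = existT (fun y => hom y x) x (idm x).
Proof. by case: p => y f /= idf; case: y x f / idf. Qed.

Section SliceSum.
Variables (C : category) (X : sd_ob C).

Local Notation letter := {set 'I_(len X).+1}.

Lemma size_face_word (w : seq letter) :
  face_word w -> (0 < size w <= (len X).+1)%N.
Proof.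
move=> [Y [f ->]]; rewrite size_word_of ltnS /=.
exact: (sd_hom_len (\pi_(sd_hom Y X) f)).
Qed.

(** The alphabet is finite and the size of a face word is bounded. *)
Lemma finite_face_word : finite_set (@face_word C X).
Proof.
apply: (@sub_finite_set _ _
  ((fun w : (len X).+1.-bseq letter => w : seq letter) @` setT)).
  move=> w /size_face_word /andP[_ hw].
  by exists (Bseq hw).
exact/finite_image/finite_finset.
Qed.

(* Adding or deleting the class of 0 in front of a word is a sign-reversing
   involution; only the one-letter word made of that class is left alone. *)
Lemma face_word_sum :
  set_sum (@face_word C X) (fun w => (-1) ^+ (size w).-1) = 1.
Proof.
set c0 := collapse_class (sd_functor X) ord0.
pose E := enum_fset (fset_set (@face_word C X : set {classic (seq letter)})).
have memE w : w \in E <-> face_word w := mem_fset_classic w finite_face_word.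
pose B : seq {classic (seq letter)} := [seq w <- E | ohead w != Some c0].
have memB w : w \in B <-> face_word w /\ ohead w != Some c0.
  rewrite mem_filter; split=> [/andP[-> /memE] //|[/memE -> ->] //].
rewrite (@set_sum_enum _ _ _ (([:: c0] : {classic (seq letter)}) ::
   B ++ map (cons c0 : {classic (seq letter)} -> {classic (seq letter)}) B)).
- rewrite big_cons big_cat big_map /= -[RHS]addr0; congr (_ + _).
  (* Face words are nonempty, so prepending [c0] raises [(size w).-1] by one; for the empty word
     both exponents would be 0. *)
  rewrite -big_split /= big_seq big1 // => w /memB [/size_face_word].
  by case: w => // a w _ _; rewrite exprS mulN1r subrr.
- exact: finite_face_word.
- have uB : uniq B by rewrite filter_uniq ?fset_uniq.
  rewrite /= mem_cat cat_uniq uB map_inj_uniq ?uB => [|w w' []//].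
  rewrite andbT /=; apply/andP; split.
    apply/negP => /orP[/memB[_ /eqP]//|/mapP[w /memB[/size_face_word]]].
    by case: w.
  by apply/hasPn => _ /mapP[w _ ->]; apply/negP => /memB[_ /eqP].
- move=> w; rewrite inE mem_cat; split.
    move=> /or3P[/eqP ->|/memB[]//|/mapP[w' /memB[fw' hw'] ->]].
      exact: face_word_pt.
    case: w' fw' hw' => [/size_face_word //|a w'] fw' /= ha.
    by apply: face_word_cons fw' _ => e; rewrite e eqxx in ha.
  (* A longer word starting with [c0] comes from its tail, which lies in [B] because adjacent
     letters differ. *)
  move=> fw; have [hw|hw] := eqVneq (ohead w) (Some c0); last first.
    by apply/or3P/Or32/memB.
  case: w hw fw => // _ w [->] fw; case: w fw => [|b w] fw.
    by rewrite eqxx.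
  have [fw' /eqP cb] := face_word_behead fw.
  apply/or3P/Or33/mapP; exists (b :: w) => //; apply/memB; split=> //.
  by apply: contra cb => /eqP [->].
Qed.

(** By [sd_pi_collapsed] the word does not depend on the representative chosen by [repr]. *)
Definition slice_word (p : {Y : Sd C & hom Y X}) : seq letter :=
  word_of (repr (projT2 p)).

Lemma slice_word_inj : injective slice_word.
Proof. by move=> [Y F] [Y' F'] /word_of_inj; rewrite !reprK. Qed.

Lemma slice_word_range : range slice_word = @face_word C X.
Proof.
apply/seteqP; split=> [_ [[Y F] _ <-]|_ [Y [f ->]]].
  by exists Y, (repr F).
exists (existT (fun Y : Sd C => hom Y X) Y (\pi_(sd_hom Y X) f)) => //.
rewrite /slice_word /word_of /=; apply: eq_map => i; apply/collapse_classP.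
by move: i; apply/sd_pi_collapsed; rewrite reprK.
Qed.

Lemma finite_slice : finite_set [set: {Y : Sd C & hom Y X}].
Proof.
apply: (@finite_set_inj _ _ _ slice_word) => [p q _ _|].
  exact: slice_word_inj.
rewrite slice_word_range; exact: finite_face_word.
Qed.

Lemma slice_sum :
  set_sum [set: {Y : Sd C & hom Y X}] (fun p => (-1) ^+ len (projT1 p)) = 1.
Proof.
rewrite -[RHS]face_word_sum -slice_word_range set_sum_image.
- apply: eq_set_sum => [|p _]; first exact: finite_slice.
  by rewrite /= /slice_word size_word_of.
- exact: finite_slice.
- by move=> p q _ _; exact: slice_word_inj.
Qed.

(** These are the arrows that may be prepended to a nondegenerate chain starting at [X]. *)
Definition strict_slice : set {Y : Sd C & hom Y X} :=
  [set p : {Y : Sd C & hom Y X} | ~ is_id (projT2 p)].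

Lemma finite_strict_slice : finite_set strict_slice.
Proof. by apply: sub_finite_set finite_slice. Qed.

(** The identity of [X], of sign [(-1) ^+ len X], is the only term removed from the full sum. *)
Lemma strict_slice_sum :
  set_sum strict_slice (fun p => (-1) ^+ len (projT1 p)) = 1 - (-1) ^+ len X.
Proof.
have := slice_sum.
pose id_slice := existT (fun Y : Sd C => hom Y X) (X : Sd C) (idm (X : Sd C)).
rewrite (set_sumD1 (a := id_slice)) //=; last exact: finite_slice.
move=> /(canRL (addKr _)); rewrite addrC => <-.
congr set_sum; apply/seteqP; split=> [p np|p [_ np] idp].
  by split=> // e; apply: np; rewrite e; exact: IsId.
by apply: np; exact: (is_id_slice (A := Sd C) idp).
Qed.

End SliceSum.

(** * Splitting a chain into first arrow and tail *)

Section ChainSplit.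
Variable C : category.

Definition nerve_cons n (d : nd_nerve C n) (p : {x : C & hom x (projT1 d)})
    (np : ~ is_id (projT2 p)) : nd_nerve C n.+1 :=
  existT _ (projT1 p) (nd_cons (projT2 p) np (projT2 d)).

Lemma nerve_consE n (X : nd_nerve C n.+1) :
  exists d p np, X = @nerve_cons n d p np.
Proof.
case: X => x c; have [y [f [nf [c' ->]]]] := nd_chainSE c.
by exists (existT _ y c'), (existT (fun x => hom x y) x f), nf.
Qed.

(** Forgetting the proof that the first arrow is not an identity puts the result in a dependent sum
    over tails; [unit] fills the impossible length-zero case. *)
Definition nerve_split n (X : nd_nerve C n.+1) :
    {d : nd_nerve C n & {x : C & hom x (projT1 d)}} :=
  match projT2 X in nd_chain m x return
    match m return Type with
    | 0 => unit
    | m'.+1 => {d : nd_nerve C m' & {x : C & hom x (projT1 d)}}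
    end
  with
  | nd_nil _ => tt
  | nd_cons m x y f nf c => existT _ (existT _ y c) (existT _ x f)
  end.

Lemma nerve_split_cons n d p np :
  nerve_split (@nerve_cons n d p np) = existT _ d p.
Proof. by case: d p np => y c [x f]. Qed.

Lemma nerve_split_inj n : injective (@nerve_split n).
Proof.
move=> X X'.
have [d [p [np ->]]] := nerve_consE X.
have [d' [p' [np' ->]]] := nerve_consE X'.
rewrite !nerve_split_cons => e; have ed := projT1_eq e; rewrite /= in ed.
subst d'; have ep := existT_inj e; subst p'.
by rewrite (Prop_irrelevance np np').
Qed.

Lemma chain_ob0 n (X : nd_nerve C n) : chain_ob (projT2 X) 0 = projT1 X.
Proof. by case: X => x []. Qed.

Lemma finite_nd_nerve n : finite_category C -> finite_set [set: nd_nerve C n].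
Proof.
move=> [fob fhom]; elim: n => [|n IH].
  apply: (@finite_set_inj _ _ _ (fun X : nd_nerve C 0 => projT1 X)).
    move=> [x c] [x' c'] _ _ /= e; subst x'.
    by rewrite (nd_chain0E c) (nd_chain0E c').
  exact: sub_finite_set fob.
(* The type of the first arrow depends on the tail; packing it lands in a product of two finite
   sets. *)
pose h (X : nd_nerve C n.+1) :=
  (projT1 (nerve_split X), arrow (projT2 (projT2 (nerve_split X)))).
apply: (@finite_set_inj _ _ _ h); last first.
  by apply: sub_finite_set (finite_setX IH fhom) => -[].
move=> X X' _ _ e; apply: nerve_split_inj.
have := congr1 fst e; have := congr1 snd e; rewrite /h /= {e}.
move: (nerve_split X) (nerve_split X') => [d [x f]] [d' [x' f']] /= e ed.
subst d'; have ex := projT1_eq e; rewrite /= in ex; subst x'.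
by have := arrow_inj e => ->.
Qed.

End ChainSplit.

(** * Chains of the subdivision with maximal length [n] *)

Section LengthChains.
Variables (I : category) (I_finite : finite_category I) (n : nat).

Definition sd_chains i : set (nd_nerve (Sd I) i) :=
  @fil_nerve (Sd_filtered I) i n.
Arguments sd_chains : clear implicits.

(** The new first object maps to the old one, so it is no longer than it. *)
Lemma max_len_cons i d p np :
  (\max_(k < i.+2) len (chain_ob (projT2 (@nerve_cons (Sd I) i d p np)) k) =
   \max_(k < i.+1) len (chain_ob (projT2 d) k))%N.
Proof.
rewrite big_ord_recl /=; apply/maxn_idPr.
apply: leq_trans (leq_bigmax ord0); rewrite chain_ob0.
exact: (sd_hom_len (projT2 p)).
Qed.

(** Since prepending keeps the maximum, the fibre over each tail is its whole strict slice. *)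
Lemma nerve_split_chains i :
  @nerve_split (Sd I) i @` sd_chains i.+1 =
  [set q | sd_chains i (projT1 q) /\ strict_slice (projT2 q)].
Proof.
apply/seteqP; split=> [_ [X + <-]|[d p] /= [cd np]].
  have [d [p [np ->]]] := nerve_consE X.
  rewrite nerve_split_cons /sd_chains /fil_nerve /= => <-.
  by rewrite -(max_len_cons np).
exists (nerve_cons np); last exact: nerve_split_cons.
exact: etrans (max_len_cons np) cd.
Qed.

Lemma chains0_image :
  sd_chains 0 = (fun c : nd_nerve I n =>
    existT (nd_chain 0) (existT _ n c : Sd I) (nd_nil _)) @` setT.
Proof.
apply/seteqP; split=> [[[m c] d]|_ [c _ <-]]; rewrite /sd_chains /fil_nerve /=.
  rewrite (nd_chain0E d) big_ord1 /= => e; rewrite /len /= in e; subst m.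
  by exists c.
by rewrite big_ord1.
Qed.

Lemma finite_chains i : finite_set (sd_chains i).
Proof.
elim: i => [|i IH].
  by rewrite chains0_image; apply/finite_image/finite_nd_nerve.
apply: (@finite_set_inj _ _ _ (@nerve_split (Sd I) i)) => [X X' _ _|].
  exact: nerve_split_inj.
rewrite nerve_split_chains.
apply: (finite_set_sigma (A := sd_chains i)
  (B := fun d => @strict_slice I (projT1 d))) => // d _.
exact: finite_strict_slice.
Qed.

(** By acyclicity a non-identity arrow has distinct endpoints, so each step raises the length by at
    least 1. *)
Lemma chain_index_le_len i (X : nd_nerve (Sd I) i) k :
  (k <= i)%N -> (k <= len (chain_ob (projT2 X) k))%N.
Proof.
case: X => x c /=; elim: k i x c => [//|k IH] i x c ki.
have lt_k : (k <= k.+1)%N by [].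
have nid := @chain_hom_nd (Sd I) _ _ c _ lt_k ki.
apply: leq_ltn_trans (IH i x c (ltnW ki)) _.
apply: (length_filtration (C := I)); split.
  exact: (inhabits (chain_hom c lt_k)).
move=> e; apply: nid.
move: (chain_hom c lt_k); rewrite -e => F.
rewrite ((Sd_acyclic I).1 _ F); exact: IsId.
Qed.

Lemma chains_gt_empty i : (n < i)%N -> sd_chains i = set0.
Proof.
move=> ni; apply/seteqP; split=> // X /= cX.
have : (i <= n)%N.
  rewrite -cX; apply: leq_trans (chain_index_le_len X (leqnn i)) _.
  exact: (leq_bigmax (ord_max : 'I_i.+1)).
by rewrite leqNgt ni.
Qed.

(** This is the [S_i] of the telescoping argument. *)
Definition head_sum i : int :=
  set_sum (sd_chains i) (fun X => (-1) ^+ len (projT1 X)).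

(** Summing over tails first, each strict slice contributes 1 minus the sign of the head of the
    tail. *)
Lemma head_sumS i : head_sum i.+1 = (ncard (sd_chains i))%:Z - head_sum i.
Proof.
have fC := finite_chains.
transitivity (set_sum (@nerve_split (Sd I) i @` sd_chains i.+1)
    (fun q => (-1) ^+ len (projT1 (projT2 q)))).
  rewrite set_sum_image //; last by move=> X X' _ _; exact: nerve_split_inj.
  apply: eq_set_sum => // X _ /=.
  by have [d [p [np ->]]] := nerve_consE X; rewrite nerve_split_cons.
rewrite nerve_split_chains.
rewrite (set_sum_sigma (A := sd_chains i)
  (B := fun d => @strict_slice I (projT1 d))) //; last first.
  by move=> d _; exact: finite_strict_slice.
rewrite ncard_set_sum /head_sum /set_sum -sumrB.
by apply: eq_bigr => d _; exact: strict_slice_sum.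
Qed.

Lemma head_sum0 : head_sum 0 = (-1) ^+ n * nerve_series I n.
Proof.
have fN := finite_nd_nerve n I_finite.
rewrite /nerve_series ncard_set_sum /head_sum chains0_image set_sum_image //.
  by rewrite /set_sum big_distrr /=; apply: eq_bigr => c _; rewrite mulr1.
move=> c c' _ _ e; exact: existT_inj (projT1_eq e).
Qed.

Lemma f_chi_Sd : f_chi (Sd_filtered I) n = nerve_series I n.
Proof.
(* The sign is chosen so that [s i.+1 - s i] is [(-1) ^+ i] times [S_i + S_(i+1)], the i-th
   summand. *)
pose s i := - ((-1) ^+ i * head_sum i).
rewrite /f_chi.
rewrite (eq_bigr (fun i : 'I_n.+1 => s i.+1 - s i)) => [|i _]; last first.
  by rewrite /s head_sumS exprS mulN1r mulNr opprK opprK mulrBr subrK.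
rewrite -(big_mkord xpredT (fun i => s i.+1 - s i)) telescope_sumr //.
(* Only [S_0] survives, and its sign [(-1) ^+ n] cancels the one in [f_chi]. *)
rewrite /s [head_sum n.+1]/head_sum chains_gt_empty // set_sum0.
by rewrite mulr0 oppr0 sub0r opprK expr0 mul1r head_sum0 mulrA -expr2 sqrr_sign mul1r.
Qed.

End LengthChains.

Theorem mainTheorem1 (I : category)
    (I_finite : finite_category I)
    (chi_defined : chi_series_defined I) :
  chi_fil_defined (Sd_filtered I) /\
  chi_series I = chi_fil (Sd_filtered I).
Proof.
(* Equality of the two series transfers both evaluability and the value at -1. *)
have fE : f_chi (Sd_filtered I) = nerve_series I.
  by apply/funext => n; exact: f_chi_Sd.
split; last by rewrite /chi_series /chi_fil fE.
split; last by rewrite fE.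
- by move=> i n; exact: finite_chains.
- by move=> i n; exact: chains_gt_empty.
Qed.
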